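(* Let $G\cong U_n(2)$, with $D$ its set of unitary transvections. Then $\varphi(G)=n+1$ when $n\ge 5$ is odd, and $\varphi(G)=n+2$ when $n\ge 4$ is even.
   Context: $U_n(2)$ is the isometry group of the $n$-dimensional nondegenerate unitary (Hermitian) space $V$ over $\mathbb F_4$, the form $(\cdot,\cdot)$ being linear in the first variable and conjugate-linear in the second. $D$ is the set of transvections $t(v):w\mapsto w+(w,v)v$ with $v\neq 0$ singular, i.e. $(v,v)=0$. $\varphi(G)$ denotes the maximal integer $m$ for which there is an injective homomorphism $S_m\to G$ sending every transposition $(i\,j)$ into $D$. *)

(* Defs.v *)
From HB Require Import structures.
From mathcomp Require Import all_boot all_order all_fingroup all_algebra all_field.

Set Implicit Arguments.
Unset Strict Implicit.
Unset Printing Implicit Defensive.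

Import GroupScope GRing.Theory.
Local Open Scope ring_scope.

Section UnitaryGroup.

Variables (F : finFieldType) (theta : {rmorphism F -> F}) (V : vectType F).
Variable form : {hermitian V for false & theta}.

(* [finvect_type V] is [V] itself, endowed with its finType structure. Elements
   of the isometry group are the bijections of [V] that are linear and preserve
   the form; the group law is composition, [(g * h) u = h (g u)]. *)
Definition unitary_group_set : {set {perm finvect_type V}} :=
  [set g : {perm finvect_type V} |
     [forall a : F, forall u : finvect_type V, forall v : finvect_type V,
        g (a *: u + v) == a *: g u + g v]
     && [forall u : finvect_type V, forall v : finvect_type V,
           form (g u) (g v) == form u v]].

Lemma unitary_groupP (g : {perm finvect_type V}) :
  reflect (linear (g : V -> V) /\ isometry form form (g : V -> V))
          (g \in unitary_group_set).
Proof.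
rewrite inE; apply: (iffP andP) => -[lin_g iso_g]; split.
- by move=> a u v; move: lin_g => /forallP/(_ a)/forallP/(_ u)/forallP/(_ v)/eqP.
- by move=> u v; move: iso_g => /forallP/(_ u)/forallP/(_ v)/eqP.
- apply/forallP=> a; apply/forallP=> u; apply/forallP=> v.
  by apply/eqP; apply: lin_g.
- by apply/forallP=> u; apply/forallP=> v; apply/eqP; apply: iso_g.
Qed.

Lemma unitary_group_set_group : group_set unitary_group_set.
Proof.
apply/group_setP; split.
  by apply/unitary_groupP; split=> [a u v|u v]; rewrite !perm1.
move=> g h /unitary_groupP[lin_g iso_g] /unitary_groupP[lin_h iso_h].
apply/unitary_groupP; split=> [a u v|u v]; rewrite !permM.
  by rewrite lin_g lin_h.
by rewrite iso_h iso_g.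
Qed.

Canonical unitary_group := Group unitary_group_set_group.

Definition unitary_transvections : {set {perm finvect_type V}} :=
  [set g : {perm finvect_type V} |
     [exists v : finvect_type V,
        [&& v != 0, form v v == 0 &
            [forall w : finvect_type V, g w == w + form w v *: v]]]].

End UnitaryGroup.

Section SymmetricEmbeddings.

Variables (gT : finGroupType) (G : {group gT}) (D : {set gT}).

Definition sym_embeds (m : nat) : Prop :=
  exists f : {morphism [set: 'S_m] >-> gT},
    [/\ 'injm f, f @* [set: 'S_m] \subset G
      & forall i j : 'I_m, i != j -> f (tperm i j) \in D].

Definition varphi_is (m : nat) : Prop :=
  sym_embeds m /\ (forall k : nat, sym_embeds k -> (k <= m)%N).

End SymmetricEmbeddings.

(* Main.v *)
(** Lower bound: [S_m] permutes the coordinates of [F^m], and for even [m] it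
acts on the [(m - 2)]-dimensional Hermitian space [1^perp / <1>], the
transposition [(i j)] acting as the transvection along [e_i + e_j].  To avoid
the quotient, take vectors [u_i] of [V] in the role of [e_i - e_0]; the action
is then [w |-> w + \sum_i ((w, u_(s^-1 i)) - (w, u_i)) u_i].

Upper bound: the transvections [t(v_i)] that are the images of the [(i i+1)]
satisfy [(v_i, v_j) = 0] exactly when [(i i+1)] and [(j j+1)] commute, so that
the Gram matrix of the [v_i] has the zero pattern of a path.  Such a matrix is
invertible when the path has an even number of vertices, whence any even
[m < k] satisfies [m <= n] as soon as [S_k] embeds. *)
Require Import Defs.
From mathcomp Require Import all_boot all_order all_fingroup all_algebra all_field.
From mathcomp Require Import zify ring.

Set Implicit Arguments.
Unset Strict Implicit.
Unset Printing Implicit Defensive.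

Import GroupScope GRing.Theory.
Local Open Scope ring_scope.

Section Hermitian.

Variables (F : finFieldType) (theta : {rmorphism F -> F}) (V : vectType F).
Variable form : {hermitian V for false & theta}.

Lemma hermCE (u v : V) : form u v = theta (form v u).
Proof. by rewrite (hermC form) expr0 mul1r. Qed.

Lemma hermDl (u v w : V) : form (u + v) w = form u w + form v w.
Proof. exact: linearDl. Qed.

Lemma hermDr (u v w : V) : form u (v + w) = form u v + form u w.
Proof. exact: linearDr. Qed.

Lemma hermZl (a : F) (u v : V) : form (a *: u) v = a * form u v.
Proof. exact: linearZl_LR. Qed.

Lemma hermZr (a : F) (u v : V) : form u (a *: v) = theta a * form u v.
Proof. exact: linearZr_LR. Qed.

Lemma hermBl (u v w : V) : form (u - v) w = form u w - form v w.
Proof. exact: linearBl. Qed.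

Lemma hermBr (u v w : V) : form u (v - w) = form u v - form u w.
Proof. exact: linearBr. Qed.

Lemma herm_suml (I : finType) (c : I -> F) (u : I -> V) (v : V) :
  form (\sum_i c i *: u i) v = \sum_i c i * form (u i) v.
Proof.
transitivity (\sum_i form (c i *: u i) v); first exact: linear_sumlz.
by apply: eq_bigr => i _; rewrite hermZl.
Qed.

Lemma herm_sumr (I : finType) (c : I -> F) (u : I -> V) (v : V) :
  form v (\sum_i c i *: u i) = \sum_i theta (c i) * form v (u i).
Proof.
transitivity (\sum_i form v (c i *: u i)); first exact: linear_sumr.
by apply: eq_bigr => i _; rewrite hermZr.
Qed.

(** * Transvections and when they commute *)

Definition transvection_along (g : {perm finvect_type V}) (v : V) :=
  [/\ v != 0, form v v = 0 & forall w : V, g w = w + form w v *: v :> V].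

Lemma unitary_transvectionsP (g : {perm finvect_type V}) :
  reflect (exists v, transvection_along g v) (g \in unitary_transvections form).
Proof.
rewrite inE; apply: (iffP existsP) => -[v].
  move=> /and3P[v0 /eqP vv /forallP gE]; exists v; split=> // w.
  exact: (eqP (gE w)).
move=> [v0 vv gE]; exists v; apply/and3P; split=> //; first exact/eqP.
by apply/forallP=> w; apply/eqP; apply: gE.
Qed.

(** If [g] and [h] commute, then [g] fixes [h v], because it fixes [v]; hence [h v] is orthogonal to
    [v], that is, [(v, w) (w, v) = 0]. *)
Lemma transvection_commute g h v w :
  transvection_along g v -> transvection_along h w ->
  commute g h <-> form v w = 0.
Proof.
move=> [v0 vv gE] [w0 ww hE].
have wv0 : (form w v == 0) = (form v w == 0) by apply: herm_eq0C.
split=> [ghC|vw].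
  have gv : g v = v by have := gE v; rewrite vv scale0r addr0.
  have := congr1 (fun s : {perm finvect_type V} => s v) ghC.
  rewrite !permM gv => /esym ghv; have := gE (h v); rewrite ghv hE => /eqP.
  rewrite eq_sym -subr_eq0 addrC addKr hermDl vv hermZl add0r.
  rewrite scaler_eq0 (negPf v0) orbF mulf_eq0.
  by rewrite wv0 orbb => /eqP.
apply/permP=> x; rewrite !permM.
suff : h (g x) = g (h x) :> V by [].
have wv : form w v = 0 by apply/eqP; rewrite wv0 vw.
rewrite !gE !hE !hermDl !hermZl.
by rewrite vw wv !mulr0 !addr0 addrAC.
Qed.

(** * Gram matrices shaped like a path, and the upper bound *)

Definition path_gram n (v : 'I_n -> V) :=
  forall i j, (form (v i) (v j) != 0) = (i == j.+1 :> nat) || (j == i.+1 :> nat).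

(** Pairing the relation with [v (i - 1)] leaves only the coefficients at [i - 2] and [i], and the
    former vanishes by induction along the odd indices. *)
Lemma path_gram_odd_coef n (v : 'I_n -> V) (c : 'I_n -> F) :
  path_gram v -> \sum_i c i *: v i = 0 -> forall i : 'I_n, odd i -> c i = 0.
Proof.
move=> Pv c0 i; have [b] := ubnP (i : nat).
elim: b i => // b IHb i ib oi.
have i1 : (i.-1 < n)%N by rewrite (leq_ltn_trans (leq_pred _)).
pose j := Ordinal i1.
have := congr1 (form ^~ (v j)) c0; rewrite linear0l herm_suml.
rewrite (bigD1 i) //= big1 => [|l li]; last first.
  have := Pv l j; case: (eqVneq (form (v l) (v j)) 0) => [->|_].
    by rewrite mulr0.
  move=> /esym E; rewrite (IHb l) ?mul0r //.
    by move: E li oi ib; rewrite /= -val_eqE /=; lia.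
  by move: E li oi; rewrite /= -val_eqE /=; lia.
rewrite addr0 /= => /eqP; rewrite mulf_eq0.
have := Pv i j; rewrite /= prednK ?odd_gt0 // eqxx /= => /negPf->.
by rewrite orbF => /eqP.
Qed.

Lemma path_gram_dim n (v : 'I_n -> V) :
  ~~ odd n -> path_gram v -> (n <= \dim {:V})%N.
Proof.
move=> on Pv; pose X := [tuple v i | i < n].
suff /eqP fX : free X by rewrite -(size_tuple X) -fX dimvS ?subvf.
apply/freeP=> c.
under eq_bigr => i _ do rewrite -tnth_nth tnth_mktuple.
move=> c0 i; have [oi|ei] := boolP (odd i).
  exact: (path_gram_odd_coef Pv c0).
(* As [n] is even, reversing the path exchanges even and odd indices, which reduces the even
   coefficients to the odd ones. *)
pose v' := v \o @rev_ord n; pose c' := c \o @rev_ord n.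
have Pv' : path_gram v'.
  by move=> k l; rewrite Pv /=; have := ltn_ord k; have := ltn_ord l; lia.
have c'0 : \sum_k c' k *: v' k = 0.
  by move: c0; rewrite (reindex_inj rev_ord_inj).
have := path_gram_odd_coef Pv' c'0 (i := rev_ord i).
rewrite /c' /= rev_ordK; apply.
by have := ltn_ord i; move: on ei; lia.
Qed.

Lemma commute_tperm_adjacent n (i j : 'I_n) :
  commute (tperm (inord i) (inord i.+1) : 'S_n.+1) (tperm (inord j) (inord j.+1))
  <-> ~~ ((i == j.+1 :> nat) || (j == i.+1 :> nat)).
Proof.
have iE (k l : nat) : (k < n.+1)%N -> (l < n.+1)%N ->
    (@inord n k == inord l) = (k == l).
  by move=> kn ln; rewrite -val_eqE /= !inordK.
have := ltn_ord i; have := ltn_ord j => jn ln.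
have [/orP[]/eqP ij|] := boolP (_ || _).
- have [h1 h2] : inord j.+1 != inord j :> 'I_n.+1
      /\ inord j.+2 != inord j :> 'I_n.+1.
    by split; rewrite iE; lia.
  (* At the lowest of the three points involved, one product takes the value [j + 1] and the other
     [j + 2]. *)
  split=> // /permP/(_ (inord j)).
  rewrite !permM ij tpermL (tpermD h1 h2) !tpermL.
  by move/eqP; rewrite iE; lia.
- have [h1 h2] : inord i.+1 != inord i :> 'I_n.+1
      /\ inord i.+2 != inord i :> 'I_n.+1.
    by split; rewrite iE; lia.
  split=> // /permP/(_ (inord i)).
  rewrite !permM ij tpermL (tpermD h1 h2) !tpermL.
  by move/eqP; rewrite iE; lia.
move=> ij; split=> // _; have [->//|nij] := eqVneq i j.
rewrite -val_eqE /= in nij.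
by apply/commgP/conjg_fixP; rewrite tpermJ !tpermD // iE //; lia.
Qed.

(** Since [f] is injective, the images of adjacent transpositions commute only when the
    transpositions do, so both zero and nonzero entries of the Gram matrix are determined. *)
Lemma sym_embeds_dim (G : {group {perm finvect_type V}}) (m k : nat) :
  sym_embeds G (unitary_transvections form) k ->
  ~~ odd m -> (m < k)%N -> (m <= \dim {:V})%N.
Proof.
case: k => // k [f [injf _ fD]] om mk.
have t_tr (i : 'I_m) : exists v,
    transvection_along (f (tperm (inord i) (inord i.+1))) v.
  apply/unitary_transvectionsP/fD.
  have := ltn_ord i => im.
  by rewrite -val_eqE /= !inordK //; lia.
have [v vP] := fin_all_exists t_tr.
apply: (path_gram_dim (v := v)) => // i j.
have cij := transvection_commute (vP i) (vP j).
have := commute_tperm_adjacent (widen_ord (mk : m <= k)%N i)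
  (widen_ord (mk : m <= k)%N j).
rewrite /=; set x := tperm _ _; set y := tperm _ _ => cxy.
apply/idP/idP => [nij|ij].
  apply: contraNT nij => /cxy.2 xy; apply/eqP/cij.1.
  by rewrite /commute -!morphM ?inE // xy.
apply/eqP=> /cij.2 fxy; move: ij; apply/negP/cxy.1.
by apply: (injmP injf); rewrite ?inE // !morphM ?inE.
Qed.

(** * The isometric action of the symmetric group *)

Section PermutationAction.

(* Modulo the rank one terms [p i] and [q j], which vanish on families of
   coefficients of sum zero, the [u i] are orthonormal. *)
Variables (m : nat) (u : 'I_m -> V) (p q : 'I_m -> F).
Hypothesis gram_u : forall i j, form (u i) (u j) = (i == j)%:R + p i + q j.

Definition perm_coef (s : 'S_m) (w : V) i :=
  form w (u (s^-1%g i)) - form w (u i).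

Definition perm_act (s : 'S_m) (w : V) := w + \sum_i perm_coef s w i *: u i.

Lemma sum_perm_coef s w : \sum_i perm_coef s w i = 0.
Proof.
rewrite sumrB [X in _ - X](reindex_inj (@perm_inj _ s^-1%g)).
by rewrite subrr.
Qed.

(** The coefficients sum to zero, so [q] drops out, and [p] contributes a term independent of [j].
    Differences of values [(w, u j)] are therefore simply permuted. *)
Lemma form_perm_act s w j : form (perm_act s w) (u j) =
  form w (u (s^-1%g j)) + \sum_i perm_coef s w i * p i.
Proof.
rewrite hermDl herm_suml.
under eq_bigr => i _ do rewrite gram_u !mulrDr.
rewrite !big_split /= -mulr_suml sum_perm_coef mul0r addr0.
rewrite (bigD1 j) //= big1 => [|i /negPf->]; last by rewrite mulr0.
by rewrite eqxx mulr1 addr0 addrA /perm_coef [X in X + _]addrC subrK.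
Qed.

Lemma perm_actM s t w : perm_act (s * t) w = perm_act t (perm_act s w).
Proof.
rewrite {2}/perm_act {2}/perm_act -addrA -big_split /=; congr (w + _).
apply: eq_bigr => i _; rewrite -scalerDl; congr (_ *: _).
(* The constants cancel in each difference, and the two coefficients telescope. *)
rewrite /perm_coef !form_perm_act invMg permM; ring.
Qed.

Lemma perm_act1 w : perm_act 1 w = w.
Proof.
rewrite /perm_act big1 ?addr0 // => i _.
by rewrite /perm_coef invg1 perm1 subrr scale0r.
Qed.

Lemma perm_act_inj s : injective (perm_act s).
Proof.
apply: (can_inj (g := perm_act s^-1%g)) => w.
by rewrite -perm_actM mulgV perm_act1.
Qed.

Lemma perm_act_linear s : linear (perm_act s).
Proof.
move=> a v w; rewrite /perm_act scalerDr scaler_sumr addrACA -big_split /=.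
congr (_ + _); apply: eq_bigr => i _.
rewrite scalerA -scalerDl /perm_coef !hermDl !hermZl; congr (_ *: _).
by rewrite mulrBr opprD addrACA.
Qed.

Lemma perm_act_isometry s : isometry form form (perm_act s).
Proof.
move=> v w; rewrite {2}/perm_act hermDr herm_sumr.
under eq_bigr => i _ do rewrite form_perm_act mulrDr.
rewrite big_split /= -mulr_suml -rmorph_sum sum_perm_coef rmorph0 mul0r addr0.
rewrite /perm_act hermDl herm_suml -addrA -big_split /=.
(* The correction to [(v, w)] is the sum of [h (s^-1 i) - h i], which vanishes by reindexing. *)
pose h i := form v (u i) * theta (form w (u i)).
rewrite (eq_bigr (fun i => h (s^-1%g i) - h i)) => [|i _].
  rewrite sumrB [X in _ - X](reindex_inj (@perm_inj _ s^-1%g)).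
  by rewrite subrr addr0.
by rewrite (hermCE (u i)) /perm_coef /h rmorphB; ring.
Qed.

Definition perm_act_perm (s : 'S_m) : {perm finvect_type V} :=
  perm (@perm_act_inj s
    : injective (perm_act s : finvect_type V -> finvect_type V)).

Lemma perm_act_permE s w : perm_act_perm s w = perm_act s w.
Proof. exact: permE. Qed.

Lemma perm_act_permM :
  {in [set: 'S_m] &, {morph perm_act_perm : s t / (s * t)%g}}.
Proof.
by move=> s t _ _; apply/permP=> w; rewrite permM !perm_act_permE perm_actM.
Qed.

Canonical perm_act_morphism := Morphism perm_act_permM.

Lemma perm_act_perm_unitary s : perm_act_perm s \in unitary_group form.
Proof.
apply/unitary_groupP; split=> [a v w|v w]; rewrite !perm_act_permE.
  exact: perm_act_linear.
exact: perm_act_isometry.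
Qed.

Lemma perm_act_perm_tperm i j : 2 \in [pchar F] -> (2 < m)%N -> i != j ->
  perm_act_perm (tperm i j) \in unitary_transvections form.
Proof.
move=> char2 m_gt2 ij; apply/unitary_transvectionsP; exists (u i - u j).
(* A third index certifies [u i != u j]: the pairing of [u i - u j] with [u i - u k] is 1, whereas
   its pairing with itself is 2, which is 0 here. *)
have [k [ki kj]] : exists k, k != i /\ k != j.
  have /card_gt0P[k] : (0 < #|~: [set i; j]|)%N.
    by rewrite cardsCs setCK card_ord cards2 ij subn_gt0.
  by rewrite !inE negb_or => /andP[ki kj]; exists k.
split.
- apply: contra_neq (oner_neq0 F) => uij.
  transitivity (form (u i - u j) (u i - u k)).
    rewrite hermBl !hermBr !gram_u eqxx (eq_sym j i) (negPf ij).
    rewrite (eq_sym i k) (eq_sym j k) (negPf ki) (negPf kj) /=.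
    by rewrite ?mulr1n ?mulr0n; ring.
  by rewrite uij -(scale0r 0) hermZl mul0r.
- rewrite hermBl !hermBr !gram_u !eqxx (eq_sym j i) (negPf ij).
  by rewrite -[RHS](pcharf0 char2) /= ?mulr1n ?mulr0n; ring.
move=> w; rewrite perm_act_permE; congr (w + _).
rewrite (bigD1 i) //= (bigD1 j) 1?eq_sym //= big1 => [|l /andP[li lj]].
  rewrite /perm_coef tpermV tpermL tpermR addr0 hermBr.
  rewrite -(opprB (form w (u i))) [RHS]scalerBr -[in RHS]scaleNr.
  by rewrite !(oppr_pchar2 char2).
by rewrite /perm_coef tpermV tpermD 1?eq_sym // subrr scale0r.
Qed.

(** If [s] acts trivially, then for each [w] the difference [(w, u j) - (w, u (s^-1 j))] does not
    depend on [j]. For [w = u x - u l], with [x] moved by [s], it is 1 at [x] and 0 at a suitable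
    [y]. *)
Lemma perm_act_perm_injm : (4 < m)%N -> 'injm perm_act_morphism.
Proof.
move=> m_gt4; apply/subsetP=> s /mker /= s1.
have {}s1 w : perm_act s w = w by rewrite -perm_act_permE s1 perm1.
rewrite inE; apply/eqP/permP=> x; rewrite perm1.
pose t := s^-1%g; suff: t x = x by move=> {1}<-; rewrite permKV.
apply: contraTeq (oner_neq0 F) => tx; rewrite negbK.
have [l] : exists l, l \notin [set x; t x].
  have /card_gt0P[l] : (0 < #|~: [set x; t x]|)%N.
    by rewrite cardsCs setCK card_ord cards2; lia.
  by rewrite inE; exists l.
rewrite !inE negb_or => /andP[lx ltx].
(* Outside [A], neither [y] nor [s^-1 y] meets [x] or [l]; [A] has at most 4 elements, whence the
   bound on [m]. *)
pose A := [set x; l] :|: s @: [set x; l].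
have /card_gt0P[y] : (0 < #|~: A|)%N.
  rewrite cardsCs setCK card_ord subn_gt0 (leq_ltn_trans _ m_gt4) //.
  rewrite (leq_trans (leq_card_setU _ _)) // (leq_add (n1 := 2) (n2 := 2)) //.
    by rewrite cards2; case: eqP.
  by rewrite (leq_trans (leq_imset_card _ _)) // cards2; case: eqP.
rewrite !inE !negb_or => /andP[/andP[yx yl] ys].
have tyx : t y != x.
  move: ys; apply: contraNneq => <-; apply/imsetP.
  by exists (t y); rewrite ?permKV // !inE eqxx.
have tyl : t y != l.
  move: ys; apply: contraNneq => <-; apply/imsetP.
  by exists (t y); rewrite ?permKV // !inE eqxx orbT.
have cst j : form (u x - u l) (u j) - form (u x - u l) (u (t j)) =
   \sum_i perm_coef s (u x - u l) i * p i.
  by rewrite -{1}[u x - u l]s1 form_perm_act addrC addKr.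
have := etrans (cst x) (esym (cst y)).
rewrite !hermBl !gram_u eqxx (negPf lx) (eq_sym x (t x)) (negPf tx) (negPf ltx).
rewrite (eq_sym x y) (negPf yx) (eq_sym l y) (negPf yl).
rewrite (eq_sym x (t y)) (negPf tyx) (eq_sym l (t y)) (negPf tyl).
set a := (X in X = _ -> _); set b := (X in _ = X -> _) => ab.
apply/eqP; transitivity (a - b); last by rewrite ab subrr.
by rewrite /a /b /= ?mulr1n ?mulr0n; ring.
Qed.

End PermutationAction.

(** * Unitary geometry over the field with four elements, and the lower bound *)

Section QuaternaryField.

Hypotheses (card_F : #|F| = 4%N) (theta_conj : forall x, theta x = x ^+ 2).

(** Squaring is additive because it equals [theta]; applied to [1 + 1] this gives [4 = 2]. *)
Lemma quaternary_char2 : 2 \in [pchar F].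
Proof.
rewrite inE /=; have := theta_conj (1 + 1); rewrite rmorphD rmorph1 => /eqP.
by rewrite -subr_eq0 (_ : _ - _ = - 2%:R); [rewrite oppr_eq0 | ring].
Qed.

Lemma herm_norm_eq1 (v : V) : form v v != 0 -> form v v = 1.
Proof.
move=> v0; apply: (mulfI v0); rewrite mulr1 -expr2 -theta_conj.
by rewrite -hermCE.
Qed.

Lemma quaternary_root : exists c : F, 1 + c + c ^+ 2 = 0.
Proof.
have /card_gt0P[c] : (0 < #|~: [set 0%R; 1%R : F]|)%N.
  by rewrite cardsCs setCK card_F cards2 subn_gt0; case: eqP.
rewrite !inE negb_or => /andP[c0 c1]; exists c.
have := expf_card c; rewrite card_F => c4.
apply/eqP; move: c4 => /eqP; rewrite -subr_eq0.
have -> : c ^+ 4 - c = c * ((c - 1) * (1 + c + c ^+ 2)) by ring.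
by rewrite !mulf_eq0 (negPf c0) subr_eq0 (negPf c1).
Qed.

(** Stated relative to a subspace so that the induction in [simplex_vectors] can pass to orthogonal
    complements within [V]. *)
Definition nondegenerate_on (U : {vspace V}) :=
  forall x, x \in U -> x != 0 -> exists2 y, y \in U & form x y != 0.

Lemma singular_vector (U : {vspace V}) :
  (1 < \dim U)%N -> exists2 x, x \in U & (x != 0) && (form x x == 0).
Proof.
move=> dimU.
have [x xU x0] : exists2 x, x \in U & x != 0.
  exists (vpick U); first exact: memv_pick.
  by rewrite vpick0 -dimv_eq0 -lt0n ltnW.
have [xx|/herm_norm_eq1 xx] := eqVneq (form x x) 0.
  by exists x => //; rewrite x0 xx eqxx.
pose W := (U :&: orthov form <[x]>)%VS.
have dimW : (0 < \dim W)%N.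
  by rewrite (leq_trans _ (leq_dim_orthov1 form x U)) // -subn1 subn_gt0.
have : vpick W \in W by apply: memv_pick.
have : vpick W != 0 by rewrite vpick0 -dimv_eq0 -lt0n.
move: (vpick W) => y y0; rewrite memv_cap mem_orthov1 => /andP[yU /eqP yx].
have [yy|/herm_norm_eq1 yy] := eqVneq (form y y) 0.
  by exists y => //; rewrite y0 yy eqxx.
(* Two orthogonal vectors of norm 1 have a sum of norm [1 + 1 = 0]. *)
exists (x + y); first exact: memvD.
have xy : form x y = 0 by rewrite hermCE yx rmorph0.
apply/andP; split; last first.
  rewrite hermDl !hermDr xx yy xy yx addr0 add0r.
  by rewrite (addrr_pchar2 quaternary_char2).
apply: contra_neq (oner_neq0 F) => xy0.
by rewrite -xx -[LHS]addr0 -yx -hermDl xy0 -(scale0r 0) hermZl mul0r.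
Qed.

Lemma hyperbolic_pair (U : {vspace V}) :
  nondegenerate_on U -> (1 < \dim U)%N ->
  exists p q, [/\ p \in U, q \in U &
    [/\ form p p = 0, form q q = 0 & form p q = 1]].
Proof.
move=> ndU /singular_vector[p pU /andP[p0 /eqP pp]].
have [y yU py] := ndU p pU p0.
pose z := (form y p)^-1 *: y.
have yp : form y p != 0 by rewrite (herm_eq0C form) in py.
have zp : form z p = 1 by rewrite hermZl mulVf.
have pz : form p z = 1 by rewrite hermCE zp rmorph1.
have zU : z \in U by apply: memvZ.
clearbody z.
have [zz|/herm_norm_eq1 zz] := eqVneq (form z z) 0.
  by exists p, z.
have [c c_root] := quaternary_root.
(* Adding [c *: p] to [z] keeps the pairing with [p] and changes the norm from 1 to
   [1 + c + c ^+ 2 = 0]. *)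
exists p, (z + c *: p); split=> //; first by rewrite memvD ?memvZ.
split=> //; last by rewrite hermDr hermZr pp mulr0 addr0.
rewrite hermDl !hermDr !hermZl !hermZr pp pz zp zz theta_conj -[RHS]c_root; ring.
Qed.

Lemma nondegenerate_on_complement (U : {vspace V}) p q :
  nondegenerate_on U -> p \in U -> q \in U ->
  form p p = 0 -> form q q = 0 -> form p q = 1 ->
  nondegenerate_on (U :&: orthov form <[p]> :&: orthov form <[q]>).
Proof.
move=> ndU pU qU pp qq pq x; rewrite !memv_cap !mem_orthov1.
move=> /andP[/andP[xU /eqP xp] /eqP xq] x0.
have qp : form q p = 1 by rewrite hermCE pq rmorph1.
have [y yU xy] := ndU x xU x0.
(* This is the projection of [y] to the complement of the hyperbolic plane; its pairing with [x] is
   that of [y]. *)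
exists (y - form y q *: p - form y p *: q).
  rewrite !memv_cap !mem_orthov1 !memvB ?memvZ //=.
  rewrite !hermBl !hermZl pp qq pq qp !mulr0 !mulr1 !subr0.
  by rewrite !subrr eqxx.
by rewrite !hermBr !hermZr xp xq !mulr0 !subr0.
Qed.

(** The [2k + 1] vectors are built by splitting off a hyperbolic pair [p], [q] and shifting the
    vectors [e i] of its complement to [p + q + e i]: as [(p + q, p + q) = 2 = 0], their mutual
    products are unchanged, while those with [p] and [q] become 1. *)
Lemma simplex_vectors k (U : {vspace V}) :
  nondegenerate_on U -> (k.*2 <= \dim U)%N ->
  exists e : nat -> V, (forall i, e i \in U) /\
    forall i j, (i <= k.*2)%N -> (j <= k.*2)%N ->
      form (e i) (e j) = (i != j)%:R.
Proof.
elim: k U => [|k IHk] U ndU dimU.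
  exists (fun=> 0); split=> [i|[|i] [|j]] //; first exact: mem0v.
  by rewrite -(scale0r 0) hermZl mul0r.
have [|p [q [pU qU [pp qq pq]]]] := hyperbolic_pair ndU.
  by rewrite (leq_trans _ dimU).
have qp : form q p = 1 by rewrite hermCE pq rmorph1.
pose W := (U :&: orthov form <[p]> :&: orthov form <[q]>)%VS.
have dimW : (k.*2 <= \dim W)%N.
  rewrite (leq_trans _ (leq_dim_orthov1 form q _)) //.
  have := leq_dim_orthov1 form p U; move: dimU; rewrite doubleS; lia.
have ndW := nondegenerate_on_complement ndU pU qU pp qq pq.
have [e [eW gram_e]] := IHk W ndW dimW.
have {eW} eP i : [/\ e i \in U, form (e i) p = 0 & form (e i) q = 0].
  have := eW i; rewrite !memv_cap !mem_orthov1.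
  by move=> /andP[/andP[-> /eqP-> /eqP->]].
have ep i : form (e i) p = 0 by have [] := eP i.
have eq_0 i : form (e i) q = 0 by have [] := eP i.
have pe i : form p (e i) = 0 by rewrite hermCE ep rmorph0.
have qe i : form q (e i) = 0 by rewrite hermCE eq_0 rmorph0.
exists (fun i =>
  if i is i'.+2 then p + q + e i' else if i == 0%N then p else q).
split=> [[|[|i]]|] //=; first by rewrite !memvD //; have [] := eP i.
move=> [|[|i]] [|[|j]] // ik jk; rewrite /= ?(hermDl, hermDr);
  rewrite ?(pp, qq, pq, qp, pe, qe, ep, eq_0) ?(addr0, add0r) //.
by rewrite gram_e // (addrr_pchar2 quaternary_char2) add0r.
Qed.


Lemma nondegenerate_on_fullv :
  nondegenerate form -> nondegenerate_on fullv.
Proof.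
move=> ndf x _ x0; apply/mem_orthovPn.
by move: ndf => /eqP ->; rewrite memv0.
Qed.

Lemma sym_embeds_unitary k : (2 <= k)%N -> (k.*2 <= \dim {:V})%N ->
  nondegenerate form ->
  sym_embeds (unitary_group form) (unitary_transvections form) k.*2.+2.
Proof.
move=> k2 dimk /nondegenerate_on_fullv ndf.
have [e [_ gram_e]] := simplex_vectors ndf dimk.
have char2 := quaternary_char2.
(* The zero vector, placed at the last index, supplies the extra point. In characteristic 2,
   [(i != j)%:R] is [(i == j)%:R + 1]; [p] gives this 1 away from the last index, and [q] corrects
   the column of that index. *)
pose u (i : 'I_k.*2.+2) := if i == ord_max then 0 else e i.
pose p (i : 'I_k.*2.+2) : F := (i != ord_max)%:R.
pose q (i : 'I_k.*2.+2) : F := (i == ord_max)%:R.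
have h0 (v : V) : form 0 v = 0 by rewrite -(scale0r 0) hermZl mul0r.
have gram_u i j : form (u i) (u j) = (i == j)%:R + p i + q j.
  rewrite /u /p /q; have [->|ni] := eqVneq i ord_max.
    rewrite h0 /= addr0 eq_sym.
    by case: eqP => _; rewrite /= ?addr0 // (addrr_pchar2 char2).
  have [->|nj] := eqVneq j ord_max.
    by rewrite hermCE h0 rmorph0 (negPf ni) /= add0r (addrr_pchar2 char2).
  have le (l : 'I_k.*2.+2) : l != ord_max -> (l <= k.*2)%N.
    by rewrite -val_eqE /=; have := ltn_ord l; lia.
  rewrite gram_e ?le // val_eqE; case: eqP => _ /=.
    by rewrite addr0 (addrr_pchar2 char2).
  by rewrite add0r addr0.
have m4 : (4 < k.*2.+2)%N by lia.
exists (perm_act_morphism gram_u); split.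
- exact: perm_act_perm_injm.
- by apply/subsetP=> g /morphimP[s _ _ ->]; apply: perm_act_perm_unitary.
by move=> i j; apply: perm_act_perm_tperm => //; apply: ltnW (ltnW m4).
Qed.

End QuaternaryField.
End Hermitian.

Theorem proposition3
    (F : finFieldType) (card_F : #|F| = 4%N)
    (theta : {rmorphism F -> F}) (theta_conj : forall x : F, theta x = x ^+ 2)
    (n : nat) (V : vectType F) (dim_V : \dim {:V} = n)
    (form : {hermitian V for false & theta}) (form_nd : nondegenerate form) :
  (odd n -> (5 <= n)%N ->
     varphi_is (unitary_group form) (unitary_transvections form) (n + 1)%N) /\
  (~~ odd n -> (4 <= n)%N ->
     varphi_is (unitary_group form) (unitary_transvections form) (n + 2)%N).
Proof.
split=> on n_big; split.
- have -> : (n + 1 = n./2.*2.+2)%N by lia.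
  apply: sym_embeds_unitary => //; first lia.
  by rewrite dim_V; lia.
- move=> k emb; rewrite leqNgt; apply/negP => nk.
  (* The path has [n + 1] vertices, the least even number exceeding [n]; for even [n] it is
     [n + 2]. *)
  have := @sym_embeds_dim _ _ _ _ _ (n + 1) _ emb.
  by rewrite dim_V; lia.
- have -> : (n + 2 = n./2.*2.+2)%N by lia.
  apply: sym_embeds_unitary => //; first lia.
  by rewrite dim_V; lia.
- move=> k emb; rewrite leqNgt; apply/negP => nk.
  have := @sym_embeds_dim _ _ _ _ _ (n + 2) _ emb.
  by rewrite dim_V; lia.
Qed.
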